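(* Let $X$ be a (nonempty) latin rumple. The following conditions are equivalent: (1) $X$ is affine; (2) the group $\mathrm{Dis}(X)$ is abelian and normal in $\mathrm{Mlt}(X)$.
   Context: A left quasigroup is a binary algebra $(X,\cdot)$ in which all left translations $L_x:y\mapsto xy$ are bijections of $X$; a quasigroup is one in which also all right translations $R_x:y\mapsto yx$ are bijections. A rumple is a left quasigroup whose squaring map $x\mapsto xx$ is a bijection and which satisfies $(xy)(xz)=(yx)(yz)$ for all $x,y,z$. A latin rumple is a rumple that is a quasigroup. $X=(X,* )$ is affine if there exist an abelian group structure $(X,+)$ on the set $X$, endomorphisms $\varphi,\psi$ of $(X,+)$ and $c\in X$ such that $x*y=\varphi(x)+\psi(y)+c$ for all $x,y\in X$, where $*$ is the operation of $X$. The multiplication group is $\mathrm{Mlt}(X)=\langle L_x,R_x: x\in X\rangle$, and the displacement group is $\mathrm{Dis}(X)=\langle L_xL_y^{-1},\,L_x^{-1}L_y: x,y\in X\rangle$; both are subgroups of the symmetric group on $X$. *)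

(* Defs.v *)
From mathcomp Require Import ssreflect ssrfun ssrbool.

Set Implicit Arguments.
Unset Strict Implicit.
Unset Printing Implicit Defensive.

Section Rumples.
Variables (X : Type) (op : X -> X -> X).

Definition left_quasigroup : Prop := forall x, bijective (op x).

Definition quasigroup : Prop :=
  left_quasigroup /\ forall x, bijective (op^~ x).

Definition rumple : Prop :=
  [/\ left_quasigroup, bijective (fun x => op x x) &
      forall x y z, op (op x y) (op x z) = op (op y x) (op y z)].

Definition latin_rumple : Prop := rumple /\ quasigroup.

End Rumples.

Section Affine.
Variable X : Type.

Definition abelian_group (add : X -> X -> X) (zero : X) (opp : X -> X) : Prop :=
  [/\ associative add, commutative add, left_id zero add &
      left_inverse zero opp add].

Definition affine (op : X -> X -> X) : Prop :=
  exists (add : X -> X -> X) (zero : X) (opp : X -> X),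
    abelian_group add zero opp /\
    exists (phi psi : X -> X) (c : X),
      [/\ {morph phi : x y / add x y}, {morph psi : x y / add x y} &
          forall x y, op x y = add (add (phi x) (psi y)) c].

End Affine.

(* Subgroups of the symmetric group on [X] are represented by predicates on
   functions [X -> X]. The inverse of a permutation [f] is any [g] such that
   [inverse f g], and equality of permutations is pointwise equality. *)
Section Permutations.
Variable X : Type.
Implicit Types (f g h : X -> X) (S H G : (X -> X) -> Prop).

Definition inverse f g : Prop := cancel f g /\ cancel g f.

(* When the elements of [S] are bijections, so are those of [generated S], and
   [generated S] is closed under pointwise equality, by applying [gen_inv]
   twice. *)
Inductive generated S : (X -> X) -> Prop :=
| gen_base f : S f -> generated S f
| gen_id : generated S id
| gen_comp f g : generated S f -> generated S g -> generated S (f \o g)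
| gen_inv f g : generated S f -> inverse f g -> generated S g.

Definition perm_abelian H : Prop :=
  forall f g, H f -> H g -> f \o g =1 g \o f.

Definition perm_normal H G : Prop :=
  (forall h, H h -> G h) /\
  forall g g' h, G g -> inverse g g' -> H h -> H (g \o h \o g').

End Permutations.

Section TranslationGroups.
Variables (X : Type) (op : X -> X -> X).

Definition translation (f : X -> X) : Prop :=
  exists x, f = op x \/ f = op^~ x.

Definition Mlt : (X -> X) -> Prop := generated translation.

Definition displacement (f : X -> X) : Prop :=
  (exists x y Ly', inverse (op y) Ly' /\ f = op x \o Ly') \/
  (exists x y Lx', inverse (op x) Lx' /\ f = Lx' \o op y).

Definition Dis : (X -> X) -> Prop := generated displacement.

End TranslationGroups.

(* Main.v *)
Require Import Defs.
From mathcomp Require Import ssreflect ssrfun ssrbool.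
From Stdlib Require Import IndefiniteDescription.

(** If [X] is affine, bijectivity of the left and right translations makes
    [phi] and [psi] bijective, so [Dis X] is exactly the group of translations
    [z |-> a + z], which is abelian and is normalized by the affine maps [L_x]
    and [R_x].

    Conversely, [Dis X] is always transitive, so if it is abelian then it is
    regular. Fix [e] and [u] with [e * u = e]. The element of [Dis X] sending
    [e] to [a] is [L_x L_e^-1] with [x = R_u^-1 a], so transporting the group
    structure of [Dis X] to [X] gives [a + b = R_u^-1 a * L_e^-1 b], that is,
    [x * y = R_u x + L_e y]. Normality of [Dis X] in [Mlt X] says that [R_u]
    and [L_e] are affine over [+]. *)

Set Implicit Arguments.
Unset Strict Implicit.
Unset Printing Implicit Defensive.

(** * Subgroups generated by sets of permutations *)

Section Generated.
Variable X : Type.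
Implicit Types (f g h : X -> X) (S G : (X -> X) -> Prop).

Lemma generated_eq S f g h :
  generated S f -> inverse f g -> f =1 h -> generated S h.
Proof.
move=> Sf fg fh; have [fK gK] := fg.
apply: (gen_inv (gen_inv Sf fg)); split=> x; first by rewrite -fh gK.
by rewrite -fh fK.
Qed.

Lemma generated_sub S G :
  (forall f, S f -> generated G f) -> forall f, generated S f -> generated G f.
Proof.
move=> SG f; elim=> {f} [f /SG //||f g _ Gf _ Gg|f g _ Gf fg].
- exact: gen_id.
- exact: gen_comp.
- exact: (gen_inv Gf fg).
Qed.

End Generated.

Lemma Dis_sub_Mlt (X : Type) (op : X -> X -> X) f : Dis op f -> Mlt op f.
Proof.
have L x : Mlt op (op x) by apply: gen_base; exists x; left.
apply: generated_sub => {}f [] [x [y [L' [LK ->]]]].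
  exact: (gen_comp (L x) (gen_inv (L y) LK)).
exact: (gen_comp (gen_inv (L x) LK) (L y)).
Qed.

(** * Shifts of an abelian group and their normalizer *)

Section AbelianGroup.
Variables (X : Type) (add : X -> X -> X) (zero : X) (opp : X -> X).
Hypothesis add_group : abelian_group add zero opp.

Let addA : associative add. Proof. by case: add_group. Qed.
Let addC : commutative add. Proof. by case: add_group. Qed.
Let add0 : left_id zero add. Proof. by case: add_group. Qed.
Let addN : left_inverse zero opp add. Proof. by case: add_group. Qed.

Lemma add_left_comm : left_commutative add.
Proof. by move=> x y z; rewrite !addA (addC x). Qed.

Lemma add_interchange : interchange add add.
Proof. by move=> x y z t; rewrite -!addA (add_left_comm y). Qed.

Lemma addNK a z : add (opp a) (add a z) = z.
Proof. by rewrite addA addN add0. Qed.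

Lemma addKN a z : add a (add (opp a) z) = z.
Proof. by rewrite add_left_comm addNK. Qed.

(** The hypothesis expresses without subtraction that [g] is affine, the form in which normality
    will supply it. *)
Lemma morphism_of_affine_map g :
    (forall a b, add (g (add a b)) (g zero) = add (g a) (g b)) ->
  {morph (fun x => add (opp (g zero)) (g x)) : x y / add x y}.
Proof.
move=> gD a b; rewrite add_interchange -gD.
by rewrite (addC (g _) (g zero)) -addA addNK.
Qed.

Definition is_shift (f : X -> X) := exists a, f =1 add a.

(** For bijective [f], conjugation by [f] maps the shifts into and onto the shifts. Passing to the
    inverse swaps the two clauses, so the induction on generated groups carries both. *)
Definition normalizes_shifts (f : X -> X) :=
  (forall a, exists b, forall z, f (add a z) = add b (f z)) /\
  (forall b, exists a, forall z, f (add a z) = add b (f z)).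

Lemma is_shift_inverse f g : is_shift f -> inverse f g -> is_shift g.
Proof.
move=> [a fE] [_ gK]; exists (opp a) => z.
by rewrite -{2}(gK z) fE addNK.
Qed.

Lemma generated_shifts S f :
  (forall g, S g -> is_shift g) -> generated S f -> is_shift f.
Proof.
move=> Sshift; elim=> {f} [f /Sshift //||f g _ [a fE] _ [b gE]|f g _].
- by exists zero => z; rewrite add0.
- by exists (add a b) => z /=; rewrite fE gE addA.
- exact: is_shift_inverse.
Qed.

Lemma generated_normalizes_shifts S f :
  (forall g, S g -> normalizes_shifts g) -> generated S f ->
  normalizes_shifts f.
Proof.
move=> Snorm; elim=> {f} [f /Snorm //||f g _ [f1 f2] _ [g1 g2]|f g _ [f1 f2]].
- by split=> a; exists a.
- split=> a.
    have [b gE] := g1 a; have [c fE] := f1 b.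
    by exists c => z /=; rewrite gE fE.
  have [b fE] := f2 a; have [c gE] := g2 b.
  by exists c => z /=; rewrite gE fE.
- case=> fK gK; split=> a.
    have [b fE] := f2 a; exists b => z.
    by rewrite -{1}(gK z) -fE fK.
  have [b fE] := f1 a; exists b => z.
  by rewrite -{1}(gK z) -fE fK.
Qed.

Lemma is_shift_conj g g' h :
  normalizes_shifts g -> inverse g g' -> is_shift h ->
  is_shift (g \o h \o g').
Proof.
move=> [g1 _] [_ g'K] [a hE]; have [b gE] := g1 a.
by exists b => z /=; rewrite hE gE g'K.
Qed.

(** * Displacements and translations of an affine quasigroup *)

Section AffineOperation.
Variables (op : X -> X -> X) (phi psi : X -> X) (c : X).
Hypothesis op_quasigroup : quasigroup op.
Hypothesis phiD : {morph phi : x y / add x y}.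
Hypothesis psiD : {morph psi : x y / add x y}.
Hypothesis opE : forall x y, op x y = add (add (phi x) (psi y)) c.

Lemma affine_phi_surj a : exists x, phi x = a.
Proof.
have [_ /(_ zero) [R' _ R'K]] := op_quasigroup.
(* Solve [x * zero = a + psi zero + c] for [x], then cancel. *)
exists (R' (add (add a (psi zero)) c)).
have := R'K (add (add a (psi zero)) c); rewrite opE -!addA.
rewrite !(addC _ (add (psi zero) c)).
by move=> /(congr1 (add (opp (add (psi zero) c)))); rewrite !addNK.
Qed.

Lemma affine_psi_surj a : exists y, psi y = a.
Proof.
have [/(_ zero) [L' _ L'K] _] := op_quasigroup.
exists (L' (add (add (phi zero) a) c)).
have := L'K (add (add (phi zero) a) c); rewrite opE -!addA.
move=> /(congr1 (add (opp (phi zero)))); rewrite !addNK.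
by rewrite !(addC _ c) => /(congr1 (add (opp c))); rewrite !addNK.
Qed.

Lemma affine_op_addl a x y : op (add a x) y = add (phi a) (op x y).
Proof. by rewrite !opE phiD !addA. Qed.

Lemma affine_op_addr a x y : op x (add a y) = add (psi a) (op x y).
Proof. by rewrite !opE psiD add_left_comm !addA. Qed.

Lemma affine_Dis_shift f : Dis op f -> is_shift f.
Proof.
apply: generated_shifts => {}f [] [x [y [L' [[LK L'K] ->]]]].
  exists (phi (add (opp y) x)) => z /=.
  by rewrite -{2}(L'K z) -affine_op_addl -addA (addC x) addNK.
(* With [psi a = phi (y - x)], one gets [x * (a + z) = phi (y - x) + x * z = y * z]. *)
have [a aE] := affine_psi_surj (phi (add (opp x) y)).
exists a => z /=; rewrite -[RHS]LK affine_op_addr aE -affine_op_addl.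
by rewrite addC addKN.
Qed.

Lemma affine_shift_Dis f : is_shift f -> Dis op f.
Proof.
move=> [a fE]; have [x xE] := affine_phi_surj a.
have [/(_ zero) [L' LK L'K] _] := op_quasigroup.
(* [L_x L_zero^-1] is the shift by [phi x = a]. *)
have dE z : op x (L' z) = add a z.
  rewrite -{2}(L'K z) -xE -affine_op_addl.
  by rewrite addC add0.
apply: (@generated_eq _ _ (op x \o L') (add (opp a))) => [||z].
- by apply: gen_base; left; exists x, zero, L'.
- by split=> z; rewrite /= dE ?addNK ?addKN.
- by rewrite /= dE fE.
Qed.

Lemma affine_Mlt_normalizes f : Mlt op f -> normalizes_shifts f.
Proof.
apply: generated_normalizes_shifts => {}f [x [->|->]]; split=> a.
- by exists (psi a) => z; rewrite affine_op_addr.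
- by have [b <-] := affine_psi_surj a; exists b => z; rewrite affine_op_addr.
- by exists (phi a) => z; rewrite affine_op_addl.
- by have [b <-] := affine_phi_surj a; exists b => z; rewrite affine_op_addl.
Qed.

End AffineOperation.
End AbelianGroup.

Lemma affine_Dis_abelian_normal (X : Type) (op : X -> X -> X) :
  quasigroup op -> affine op ->
  perm_abelian (Dis op) /\ perm_normal (Dis op) (Mlt op).
Proof.
move=> opQ [add [zero [opp [addG [phi [psi [c [phiD psiD opE]]]]]]]].
have DisP f : Dis op f <-> is_shift add f.
  split; first exact: (affine_Dis_shift addG opQ phiD psiD opE).
  exact: (affine_shift_Dis addG opQ phiD opE).
split=> [f g /DisP[a fE] /DisP[b gE] z|].
  by rewrite /= !fE !gE (add_left_comm addG).
split=> [|g g' h Mg gg' /DisP hS]; first exact: Dis_sub_Mlt.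
apply/DisP; apply: is_shift_conj gg' hS.
exact: (affine_Mlt_normalizes addG opQ phiD psiD opE Mg).
Qed.

(** * The group structure carried over from an abelian [Dis op] *)

Section AbelianDisplacements.
Variables (X : Type) (op : X -> X -> X).
Hypothesis op_quasigroup : quasigroup op.
Hypothesis Dis_abelian : perm_abelian (Dis op).
Variables (e u : X) (L' R' : X -> X).
Hypothesis op_eu : op e u = e.
Hypothesis LeK : inverse (op e) L'.
Hypothesis RuK : inverse (op^~ u) R'.

Definition isotope (a b : X) := op (R' a) (L' b).

Lemma Dis_isotope a : Dis op (isotope a).
Proof. by apply: gen_base; left; exists (R' a), e, L'. Qed.

Lemma isotope_op x y : isotope (op x u) (op e y) = op x y.
Proof.
by have [[LK _] [RK _]] := (LeK, RuK); rewrite /isotope LK [R' _](RK x).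
Qed.

Lemma isotope_right_id a : isotope a e = a.
Proof.
have [[LK _] [_ R'K]] := (LeK, RuK).
by rewrite /isotope -op_eu LK [LHS](R'K a).
Qed.

(** [isotope a] lies in [Dis op] and sends [e] to [a]; evaluate the two composites of [isotope a]
    and [isotope b] at [e]. *)
Lemma isotopeC : commutative isotope.
Proof.
move=> a b; rewrite -{1}(isotope_right_id b) -{2}(isotope_right_id a).
exact: (Dis_abelian (Dis_isotope a) (Dis_isotope b)).
Qed.

(** Regularity: since [f] commutes with [isotope b], its value at [b = isotope b e] is determined by
    [f e]. *)
Lemma Dis_isotopeE f : Dis op f -> f =1 isotope (f e).
Proof.
move=> Df b; rewrite isotopeC -{1}(isotope_right_id b).
exact: (Dis_abelian Df (Dis_isotope b)).
Qed.

Lemma isotopeA : associative isotope.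
Proof.
move=> a b c.
rewrite [LHS](Dis_isotopeE (gen_comp (Dis_isotope a) (Dis_isotope b)) c).
by rewrite /= isotope_right_id.
Qed.

Lemma isotope_abelian_group : exists opp, abelian_group isotope e opp.
Proof.
have [opp oppP] : exists opp, forall a, isotope (opp a) a = e.
  (* The inverse of [a] is [e * y], where [y] solves [R' a * y = e]. *)
  apply: (functional_choice (fun a b => isotope b a = e)) => a.
  have [/(_ (R' a)) [g _ gK] _] := op_quasigroup; have [LK _] := LeK.
  by exists (op e (g e)); rewrite isotopeC /isotope LK gK.
exists opp; split=> // [||a].
- exact: isotopeA.
- exact: isotopeC.
- by rewrite isotopeC isotope_right_id.
Qed.

Hypothesis Dis_normal : perm_normal (Dis op) (Mlt op).

(** By normality, the conjugate of [isotope a] by [g] is some [isotope d], so [g (a + z) = d + g z];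
    comparing [z = b] with [z = e] eliminates [d]. *)
Lemma Mlt_affine_map g g' a b : Mlt op g -> inverse g g' ->
  isotope (g (isotope a b)) (g e) = isotope (g a) (g b).
Proof.
move=> Mg gg'; have [_ /(_ g g' _ Mg gg' (Dis_isotope a)) Dh] := Dis_normal.
have [gK _] := gg'; set h := _ \o g' in Dh.
have hE z : g (isotope a z) = isotope (h e) (g z).
  by rewrite -(Dis_isotopeE Dh) /h /= gK.
rewrite hE -{1}(isotope_right_id a) hE -!isotopeA.
by rewrite (isotopeC (g b)).
Qed.

Lemma Dis_abelian_normal_affine : affine op.
Proof.
have [opp addG] := isotope_abelian_group.
have [_ addC _ _] := addG.
have ML : Mlt op (op e) by apply: gen_base; exists e; left.
have MR : Mlt op (op^~ u) by apply: gen_base; exists u; right.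
exists isotope, e, opp; split=> //.
(* The linear parts of [R_u] and [L_e]; their values at [e] are collected in the constant. *)
exists (fun x => isotope (opp (op e u)) (op x u)).
exists (fun y => isotope (opp (op e e)) (op e y)).
exists (isotope (op e u) (op e e)); split.
- apply: (morphism_of_affine_map addG (g := op^~ u)) => a b.
  exact: (Mlt_affine_map a b MR RuK).
- apply: (morphism_of_affine_map addG (g := op e)) => a b.
  exact: (Mlt_affine_map a b ML LeK).
- move=> x y; rewrite addC (add_interchange addG) !(addKN addG).
  by rewrite isotope_op.
Qed.

End AbelianDisplacements.

Theorem theorem4p18 (X : Type) (op : X -> X -> X)
    (X_nonempty : inhabited X) (X_latin : latin_rumple op) :
  affine op <-> perm_abelian (Dis op) /\ perm_normal (Dis op) (Mlt op).
Proof.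
have [_ opQ] := X_latin; split; first exact: affine_Dis_abelian_normal.
case: X_nonempty => e [Dab Dnorm]; have [opL opR] := opQ.
(* [L' e] serves as [u], the solution of [e * u = e]. *)
have [L' LK L'K] := opL e; have [R' RK R'K] := opR (L' e).
exact: (Dis_abelian_normal_affine opQ Dab (L'K e) (conj LK L'K) (conj RK R'K)).
Qed.
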